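(* If $\mathcal{C}$ is a uniform clutter with the max-flow min-cut property, then its incidence matrix $A$ diagonalizes over $\mathbb{Z}$ to an identity matrix.
   Context: A clutter $\mathcal{C}$ with finite vertex set $X=\{x_1,\ldots,x_n\}$ is a family of subsets of $X$ (called edges), none of which is included in another. Standing assumption: $\mathcal{C}$ has no isolated vertices, i.e., each vertex lies in at least one edge. $\mathcal{C}$ is uniform if all its edges have the same number of vertices. If $f_1,\ldots,f_q$ are the edges, the incidence matrix $A$ is the $n\times q$ matrix whose columns are $v_k=\sum_{x_i\in f_k}e_i\in\{0,1\}^n$. $\mathcal{C}$ has the max-flow min-cut property if for every non-negative integral vector $\alpha\in\mathbb{N}^n$ both sides of the LP-duality equation $\min\{\langle\alpha,x\rangle \mid x\geq 0,\ xA\geq\mathbf{1}\}=\max\{\langle y,\mathbf{1}\rangle \mid y\geq 0,\ Ay\leq\alpha\}$ have integral optimum solutions $x$ and $y$, where $\mathbf{1}=(1,\ldots,1)$. ''$A$ diagonalizes over $\mathbb{Z}$ to an identity matrix'' means that, using integral row and column operations, $A$ can be brought to the form $\begin{pmatrix} I_r & 0\\ 0 & 0\end{pmatrix}$ with $r=\operatorname{rank}(A)$ and $I_r$ the identity matrix of order $r$; equivalently, all the invariant factors in the Smith normal form of $A$ equal $1$. *)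

(* Defs.v *)
From HB Require Import structures.
From mathcomp Require Import all_boot all_order all_algebra.
Set Implicit Arguments.
Unset Strict Implicit.
Unset Printing Implicit Defensive.
Import Order.TTheory GRing.Theory Num.Theory.
Local Open Scope ring_scope.

Definition is_clutter (n : nat) (C : {set {set 'I_n}}) : Prop :=
  forall e f, e \in C -> f \in C -> e \subset f -> e = f.

Definition no_isolated_vertex (n : nat) (C : {set {set 'I_n}}) : Prop :=
  forall i : 'I_n, exists2 e, e \in C & i \in e.

Definition uniform (n : nat) (C : {set {set 'I_n}}) : Prop :=
  forall e f, e \in C -> f \in C -> #|e| = #|f|.

(* The edges f_1, ..., f_q are listed in the order of [enum C]. *)
Definition incidence_mx (R : pzSemiRingType) (n : nat) (C : {set {set 'I_n}}) :
    'M[R]_(n, #|C|) :=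
  \matrix_(i < n, k < #|C|) (i \in enum_val k)%:R.

Section LinearPrograms.
Variables (R : realFieldType) (n : nat) (C : {set {set 'I_n}}).
Local Notation A := (incidence_mx R C).

Definition integral_mx (p q : nat) (M : 'M[R]_(p, q)) : Prop :=
  exists N : 'M[int]_(p, q), M = map_mx intr N.

Definition min_feasible (x : 'rV[R]_n) : Prop :=
  (forall i, 0 <= x 0 i) /\ (forall k, 1 <= (x *m A) 0 k).

Definition min_objective (a : 'cV[nat]_n) (x : 'rV[R]_n) : R :=
  \sum_(i < n) (a i 0)%:R * x 0 i.

Definition min_optimal (a : 'cV[nat]_n) (x : 'rV[R]_n) : Prop :=
  min_feasible x /\
  forall x', min_feasible x' -> min_objective a x <= min_objective a x'.

Definition max_feasible (a : 'cV[nat]_n) (y : 'cV[R]_#|C|) : Prop :=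
  (forall k, 0 <= y k 0) /\ (forall i, (A *m y) i 0 <= (a i 0)%:R).

Definition max_objective (y : 'cV[R]_#|C|) : R := \sum_(k < #|C|) y k 0.

Definition max_optimal (a : 'cV[nat]_n) (y : 'cV[R]_#|C|) : Prop :=
  max_feasible a y /\
  forall y', max_feasible a y' -> max_objective y' <= max_objective y.

(* Equality of the two optimal values is the LP duality theorem, so it is not
   part of the definition. *)
Definition max_flow_min_cut : Prop :=
  forall a : 'cV[nat]_n,
    (exists2 x, integral_mx x & min_optimal a x) /\
    (exists2 y, integral_mx y & max_optimal a y).

End LinearPrograms.

Inductive int_row_op (m n : nat) (A : 'M[int]_(m, n)) : 'M[int]_(m, n) -> Prop :=
| RowSwap (i j : 'I_m) : int_row_op A (xrow i j A)
| RowOpp (i : 'I_m) :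
    int_row_op A (\matrix_(k, l) if k == i then - A k l else A k l)
| RowAdd (i j : 'I_m) (c : int) : i != j ->
    int_row_op A (\matrix_(k, l) if k == i then A k l + c * A j l else A k l).

Definition int_col_op (m n : nat) (A B : 'M[int]_(m, n)) : Prop :=
  int_row_op A^T B^T.

Inductive int_reduces (m n : nat) (A : 'M[int]_(m, n)) : 'M[int]_(m, n) -> Prop :=
| ReducesRefl : int_reduces A A
| ReducesRow B D : int_reduces A B -> int_row_op B D -> int_reduces A D
| ReducesCol B D : int_reduces A B -> int_col_op B D -> int_reduces A D.

(* [pid_mx r] is the block matrix (I_r 0; 0 0); [\rank] needs a field, so the
   rank is taken over the rationals. *)
Definition diagonalizes_to_identity (m n : nat) (A : 'M[int]_(m, n)) : Prop :=
  int_reduces A (pid_mx (\rank (map_mx intr A : 'M[rat]_(m, n)))).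

(* Main.v *)
(* If alpha = A y0 is an integral vector with y0 >= 0, then uniformity makes y0
   optimal for the packing program of capacity alpha, and makes every optimal y
   satisfy A y = alpha; an integral optimal y writes alpha as an integral
   combination of the columns of A.  Shifting an arbitrary integral vector of
   the rational column space by a large multiple of the sum of the columns
   reduces to that case, so the column lattice of A is saturated.  A saturated
   matrix reduced to (a 0; 0 B) has a = 1 or a = -1, since its lattice contains
   a multiple of the first basis vector, and B is again saturated. *)
Require Import Defs.
From HB Require Import structures.
From mathcomp Require Import all_boot all_order perm all_algebra.
Import Order.TTheory GRing.Theory Num.Theory.
Local Open Scope ring_scope.

Set Implicit Arguments.
Unset Strict Implicit.

(** * Integral row and column operations as multiplication by unimodular matrices *)

Lemma int_reduces_trans m n (A B D : 'M[int]_(m, n)) :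
  int_reduces A B -> int_reduces B D -> int_reduces A D.
Proof.
move=> AB; elim=> // [D1 D2 _ AD1 op|D1 D2 _ AD1 op].
  exact: ReducesRow AD1 op.
exact: ReducesCol AD1 op.
Qed.

Lemma int_row_op_reduces m n (A B : 'M[int]_(m, n)) :
  int_row_op A B -> int_reduces A B.
Proof. by move=> op; apply: ReducesRow op; apply: ReducesRefl. Qed.

Lemma int_reduces_tr m n (A B : 'M[int]_(m, n)) :
  int_reduces A B -> int_reduces A^T B^T.
Proof.
elim=> [|D1 D2 _ AD1 op|D1 D2 _ AD1 op]; first exact: ReducesRefl.
  by apply: ReducesCol AD1 _; rewrite /int_col_op !trmxK.
exact: ReducesRow AD1 op.
Qed.

Lemma int_row_op_mulmx m n (A B : 'M[int]_(m, n)) :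
  int_row_op A B -> exists2 E, E \in unitmx & B = E *m A.
Proof.
(* The product of [1 + c E_ij] and [1 + c' E_ij] is [1 + (c + c' + c c' [i = j]) E_ij]. One
   criterion thus covers row addition ([i != j], [c' = - c]) and sign change ([i = j],
   [c = c' = -2]). *)
have transvection (i j : 'I_m) (c c' : int) :
    c + c' + c * c' *+ (i == j) = 0 -> 1%:M + c *: delta_mx i j \in unitmx.
  move=> cc'; suff /mulmx1_unit[]:
    (1%:M + c *: delta_mx i j) *m (1%:M + c' *: delta_mx i j) = 1%:M :> 'M_m by [].
  rewrite mulmxDl mul1mx mulmxDr mulmx1 -scalemxAl -scalemxAr mul_delta_mx_cond.
  rewrite eq_sym scalerA -scalerMnr scalerMnl -!addrA -!scalerDl addrCA addrA.
  by rewrite cc' scale0r addr0.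
case=> [i j|i|i j c neq_ij].
- by exists (tperm_mx i j); rewrite ?unitmx_perm // xrowE.
- exists (1%:M + (-2) *: delta_mx i i); first by apply: (transvection _ _ _ (-2)); rewrite eqxx.
  apply/matrixP=> k l; rewrite mulmxDl mul1mx -scalemxAl !mxE (bigD1 i) //= big1 => [|h hi].
    rewrite !mxE eqxx andbT addr0; case: eqP => [->|_]; last by rewrite mul0r mulr0 addr0.
    by rewrite mul1r mulNr mulr_natl mulr2n opprD addNKr.
  by rewrite !mxE (negPf hi) andbF mul0r.
exists (1%:M + c *: delta_mx i j).
  by apply: (transvection _ _ _ (- c)); rewrite (negPf neq_ij) mulr0n addr0 subrr.
apply/matrixP=> k l; rewrite mulmxDl mul1mx -scalemxAl !mxE (bigD1 j) //= big1 => [|h hi].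
  by rewrite !mxE eqxx andbT addr0; case: eqP => [->|_]; rewrite ?mul1r ?mul0r ?mulr0 ?addr0.
by rewrite !mxE (negPf hi) andbF mul0r.
Qed.

Lemma int_reduces_mulmx m n (A B : 'M[int]_(m, n)) : int_reduces A B ->
  exists E F, [/\ E \in unitmx, F \in unitmx & B = E *m A *m F].
Proof.
elim=> [|D1 D2 _ [E [F [uE uF ->]]] op|D1 D2 _ [E [F [uE uF ->]]] op].
- by exists 1%:M, 1%:M; rewrite !unitmx1 mul1mx mulmx1.
- have [G uG ->] := int_row_op_mulmx op; exists (G *m E), F.
  by rewrite unitmx_mul uG uE !mulmxA.
- have [G uG eqD2] := int_row_op_mulmx op; exists E, (F *m G^T).
  rewrite unitmx_mul unitmx_tr uG uF !mulmxA; split=> //.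
  by rewrite -[D2]trmxK eqD2 trmx_mul trmxK.
Qed.

(** A unimodular matrix has determinant a unit, hence stays invertible over the rationals. This
    identifies the [r] of any [pid_mx r] reached from [A]. *)
Lemma int_reduces_rank m n (A B : 'M[int]_(m, n)) : int_reduces A B ->
  \rank (map_mx intr B : 'M[rat]_(m, n)) = \rank (map_mx intr A : 'M[rat]_(m, n)).
Proof.
have map_unit p (G : 'M[int]_p) : G \in unitmx -> (map_mx intr G : 'M[rat]_p) \in unitmx.
  by rewrite !unitmxE det_map_mx; apply: rmorph_unit.
move=> /int_reduces_mulmx[E [F [uE uF ->]]]; rewrite !map_mxM.
rewrite mxrankMfree ?row_free_unit ?map_unit //.
by rewrite eqmxMfull // row_full_unit map_unit.
Qed.

(** * Saturation of the column lattice, that is, torsion-freeness of the cokernel *)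

Definition saturated m n (A : 'M[int]_(m, n)) : Prop :=
  forall (c : int) (w : 'cV[int]_m) (z : 'cV[int]_n),
    c != 0 -> c *: w = A *m z -> exists z', w = A *m z'.

Lemma int_reduces_saturated m n (A B : 'M[int]_(m, n)) :
  int_reduces A B -> saturated A -> saturated B.
Proof.
move=> /int_reduces_mulmx[E [F [uE uF ->]]] satA c w z c0 cw.
have [|z' eqz'] := satA c (invmx E *m w) (F *m z) c0.
  by rewrite scalemxAr cw -!mulmxA mulKmx.
by exists (invmx F *m z'); rewrite -!mulmxA (mulKVmx uF) -eqz' mulKVmx.
Qed.

Lemma saturated_block m n (a : int) (B : 'M[int]_(m, n)) :
  a != 0 -> saturated (block_mx a%:M 0 0 B : 'M_(1 + m, 1 + n)) ->
  a \is a GRing.unit /\ saturated B.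
Proof.
move=> a0 sat; split.
  have [|z] := sat a (col_mx 1%:M 0) (col_mx 1%:M 0) a0.
    by rewrite mul_block_col scale_col_mx !mulmx0 !mul0mx !scaler0 !addr0 mulmx1 scalemx1.
  rewrite -[z]vsubmxK mul_block_col mul0mx addr0 => /eq_col_mx[/matrixP/(_ 0 0)].
  rewrite mul_scalar_mx !mxE eqxx /= => az _.
  by apply/unitrPr; exists (usubmx z 0 0); rewrite mxE -az.
move=> c w z c0 cw; have [|z'] := sat c (col_mx 0 w) (col_mx 0 z) c0.
  by rewrite mul_block_col scale_col_mx cw scaler0 !mulmx0 !mul0mx !add0r.
rewrite -[z']vsubmxK mul_block_col !mul0mx add0r => /eq_col_mx[_ ->].
by exists (dsubmx z').
Qed.

(** * Splitting off a pivot by integral elimination *)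

Lemma int_row_op_block p q m n (a : 'M[int]_(p, q)) (B D : 'M[int]_(m, n)) :
  int_row_op B D -> int_row_op (block_mx a 0 0 B) (block_mx a 0 0 D).
Proof.
case=> [i j|i|i j c neq_ij].
- have -> : block_mx a 0 0 (xrow i j B) =
      xrow (rshift p i) (rshift p j) (block_mx a 0 0 B); last exact: RowSwap.
  apply/matrixP=> k l; rewrite [RHS]mxE.
  case: (split_ordP k) => {}k ->; case: (split_ordP l) => {}l ->.
  + by rewrite tpermD ?eq_rlshift // !block_mxEul.
  + by rewrite tpermD ?eq_rlshift // !block_mxEur !mxE.
  + by rewrite -inj_tperm ?block_mxEdl ?mxE //; apply: rshift_inj.
  by rewrite -inj_tperm ?block_mxEdr ?mxE //; apply: rshift_inj.
- set D' := (X in int_row_op _ (block_mx a 0 0 X)).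
  have -> : block_mx a 0 0 D' = \matrix_(k, l)
      if k == rshift p i then - block_mx a 0 0 B k l else block_mx a 0 0 B k l;
    last exact: RowOpp.
  apply/matrixP=> k l; rewrite [RHS]mxE.
  case: (split_ordP k) => {}k ->; case: (split_ordP l) => {}l ->;
    rewrite ?eq_lrshift ?eq_rshift ?block_mxEul ?block_mxEur ?block_mxEdl ?block_mxEdr ?mxE //.
  by rewrite oppr0 if_same.
set D' := (X in int_row_op _ (block_mx a 0 0 X)).
have -> : block_mx a 0 0 D' = \matrix_(k, l)
    if k == rshift p i then block_mx a 0 0 B k l + c * block_mx a 0 0 B (rshift p j) l
    else block_mx a 0 0 B k l; last by apply: RowAdd; rewrite eq_rshift.
apply/matrixP=> k l; rewrite [RHS]mxE.
case: (split_ordP k) => {}k ->; case: (split_ordP l) => {}l ->;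
  rewrite ?eq_lrshift ?eq_rshift ?block_mxEul ?block_mxEur ?block_mxEdl ?block_mxEdr ?mxE //.
by rewrite mulr0 addr0 if_same.
Qed.

Lemma int_reduces_block p q m n (a : 'M[int]_(p, q)) (B D : 'M[int]_(m, n)) :
  int_reduces B D -> int_reduces (block_mx a 0 0 B) (block_mx a 0 0 D).
Proof.
elim=> [|D1 D2 _ red op|D1 D2 _ red op]; first exact: ReducesRefl.
  by apply: ReducesRow red _; apply: int_row_op_block.
apply: ReducesCol red _; rewrite /int_col_op !tr_block_mx !trmx0.
exact: int_row_op_block.
Qed.

Lemma int_reduces_add_row m n (u : 'rV[int]_n) (V : 'M[int]_(m, n)) (q : 'cV[int]_m) :
  int_reduces (col_mx u V) (col_mx u (V + q *m u)).
Proof.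
(* Each summand [q i 0] times a unit vector costs one elementary row addition. [V] is generalized
   because the additions accumulate in it. *)
rewrite [q]matrix_sum_delta; under eq_bigr do rewrite big_ord1.
elim/big_ind: _ V => [V|q1 q2 red1 red2 V|i _ V].
- by rewrite mul0mx addr0; apply: ReducesRefl.
- by rewrite mulmxDl addrA; apply: int_reduces_trans (red1 V) (red2 _).
apply: int_row_op_reduces.
have -> : col_mx u (V + q i 0 *: delta_mx i 0 *m u) = \matrix_(k, l)
    if k == rshift 1 i then col_mx u V k l + q i 0 * col_mx u V (lshift m 0) l
    else col_mx u V k l; last by apply: RowAdd; rewrite eq_rlshift.
apply/matrixP=> k l; rewrite [RHS]mxE.
case: (split_ordP k) => {}k ->; rewrite ?eq_lrshift ?eq_rshift ?col_mxEu ?col_mxEd //.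
rewrite -scalemxAl !mxE big_ord1 !mxE andbT.
by case: eqP => [->|_]; rewrite ?mul1r ?mul0r ?mulr0 ?addr0.
Qed.

Lemma int_reduces_clear_col m n (a : int) (u : 'rV[int]_n) (v : 'cV[int]_m)
    (V : 'M[int]_(m, n)) : (forall i, (a %| v i 0%R)%Z) ->
  exists V', int_reduces (block_mx a%:M u v V : 'M_(1 + m, 1 + n)) (block_mx a%:M u 0 V').
Proof.
(* By exact divisibility [v + a q = 0], so adding [q] times the top row clears the column below the
   pivot. *)
move=> dvd_v; pose q := \col_i - (v i 0%R %/ a)%Z : 'cV_m; exists (V + q *m u).
have := int_reduces_add_row (row_mx a%:M u) (row_mx v V) q.
rewrite mul_mx_row add_row_mx; congr (int_reduces _ (col_mx _ (row_mx _ _))).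
apply/matrixP=> i j; rewrite !mxE big_ord1 !mxE !ord1 eqxx.
by rewrite mulNr divzK ?subrr.
Qed.

(** Euclidean descent on the absolute value of a nonzero entry: it is replaced by a smaller
    remainder until it divides its whole row and column, which are then cleared. *)
Lemma int_reduces_pivot m n (A : 'M[int]_(1 + m, 1 + n)) : A != 0 ->
  exists (a : int) B, a != 0 /\ int_reduces A (block_mx a%:M 0 0 B).
Proof.
move=> /matrix0Pn[i [j Aij]].
(* The dimensions are generalized too, since the descent is also applied to the transpose. *)
have [k] := ubnP `|A i j|; elim: k m n A i j Aij => // k IHk m n A i j.
wlog [-> ->] : A i j / i = 0 /\ j = 0.
  move=> wlogA Aij ltA; pose A1 := xcol j 0 (xrow i 0 A).
  have redA : int_reduces A A1.
    apply: (@ReducesCol _ _ _ (xrow i 0 A)); first by apply/int_row_op_reduces/RowSwap.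
    by rewrite /int_col_op /A1 tr_xcol; apply: RowSwap.
  have A1E : A1 0 0 = A i j by rewrite !mxE !tpermR.
  have [||a [B [a0 redB]]] := wlogA A1 0 0 (conj erefl erefl); rewrite ?A1E //.
  by exists a, B; split=> //; apply: int_reduces_trans redA redB.
move=> A00 ltA.
(* The remainder of an entry of the pivot column is a strictly smaller pivot. *)
have improve m' n' (D : 'M[int]_(1 + m', 1 + n')) : D 0 0 = A 0 0 ->
    (exists i, ~~ (D 0%R 0%R %| D (rshift 1 i) 0%R)%Z) ->
    exists (a : int) B, a != 0 /\ int_reduces D (block_mx a%:M 0 0 B).
  move=> D00 [h ndvd]; pose c := (D (rshift 1 h) 0%R %/ D 0%R 0%R)%Z.
  pose D1 := \matrix_(k, l) if k == rshift 1 h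
    then D k l + (- c) * D (lshift m' 0) l else D k l.
  have redD : int_reduces D D1 by apply/int_row_op_reduces/RowAdd; rewrite eq_rlshift.
  have D1E : D1 (rshift 1 h) 0%R = (D (rshift 1 h) 0%R %% D 0%R 0%R)%Z.
    by rewrite mxE eqxx mulNr; congr (_ - _ * D _ _); apply: val_inj.
  have [||a [B [a0 redB]]] := IHk m' n' D1 (rshift 1 h) 0.
  - by rewrite D1E; apply: contra ndvd => /eqP/dvdz_mod0P.
  - rewrite D1E -ltz_nat gez0_abs ?modz_ge0 ?D00 //.
    by apply: lt_le_trans (ltz_mod _ A00) _; rewrite -abszE lez_nat -ltnS.
  by exists a, B; split=> //; apply: int_reduces_trans redD redB.
have [/existsP colA|] := boolP [exists i, ~~ (A 0%R 0%R %| A (rshift 1 i) 0%R)%Z].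
  exact: improve.
rewrite negb_exists => /forallP colA.
have [/existsP rowA|] := boolP [exists j, ~~ (A 0%R 0%R %| A 0%R (rshift 1 j))%Z].
  have [||a [B [a0 redB]]] := improve _ _ A^T; first by rewrite mxE.
    by have [j0 ndvd] := rowA; exists j0; rewrite !mxE.
  exists a, B^T; split=> //; have := int_reduces_tr redB.
  by rewrite trmxK tr_block_mx tr_scalar_mx !trmx0.
rewrite negb_exists => /forallP rowA.
have eqA : A = block_mx (A 0 0)%:M (ursubmx A) (dlsubmx A) (drsubmx A).
  rewrite -[LHS]submxK; congr block_mx; apply/matrixP=> x y.
  by rewrite !mxE !ord1 eqxx; congr (A _ _); apply: val_inj.
have [|V1 red1] := @int_reduces_clear_col _ _ (A 0 0) (ursubmx A) (dlsubmx A) (drsubmx A).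
  move=> h; have := colA h; rewrite negbK !mxE.
  by congr (_ %| A _ _)%Z; apply: val_inj.
(* The row is cleared as a column of the transpose. There the top row past the pivot is already [0],
   so the first clearing is not undone. *)
have [|V2 red2] := @int_reduces_clear_col _ _ (A 0 0) 0 (ursubmx A)^T V1^T.
  move=> h; have := rowA h; rewrite negbK !mxE.
  by congr (_ %| A _ _)%Z; apply: val_inj.
exists (A 0 0), V2^T; split=> //; rewrite {1}eqA; apply: int_reduces_trans red1 _.
by have := int_reduces_tr red2; rewrite !tr_block_mx !tr_scalar_mx !trmx0 !trmxK.
Qed.

Lemma int_reduces_opp_pivot m n (B : 'M[int]_(m, n)) :
  int_reduces (block_mx (-1)%:M 0 0 B : 'M_(1 + m, 1 + n)) (block_mx 1%:M 0 0 B).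
Proof.
apply: int_row_op_reduces; set M := block_mx (-1)%:M 0 0 B.
have -> : block_mx 1%:M 0 0 B =
    \matrix_(k, l) if k == lshift m 0 then - M k l else M k l; last exact: RowOpp.
apply/matrixP=> k l; rewrite [RHS]mxE.
case: (split_ordP k) => {}k ->; case: (split_ordP l) => {}l ->;
  rewrite ?eq_rlshift ?eq_lshift ?block_mxEul ?block_mxEur ?block_mxEdl ?block_mxEdr ?mxE //.
  by rewrite !ord1 eqxx opprK.
by rewrite oppr0 if_same.
Qed.

Lemma block_pid_mx (R : pzSemiRingType) m n r :
  block_mx 1%:M 0 0 (pid_mx r) = pid_mx r.+1 :> 'M[R]_(1 + m, 1 + n).
Proof.
apply/matrixP=> k l.
by case: (split_ordP k) => {}k ->; case: (split_ordP l) => {}l ->;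
  rewrite ?block_mxEul ?block_mxEur ?block_mxEdl ?block_mxEdr !mxE ?ord1 /=.
Qed.

(** Induction on the number of rows: saturation makes the pivot a unit and passes to the remaining
    block. The bounds on [r] ensure that [pid_mx r] has rank exactly [r]. *)
Lemma saturated_reduces_pid m n (A : 'M[int]_(m, n)) : saturated A ->
  exists r, [/\ r <= m, r <= n & int_reduces A (pid_mx r)]%N.
Proof.
have reduces0 p q : int_reduces (0 : 'M_(p, q)) (pid_mx 0).
  by rewrite pid_mx_0; apply: ReducesRefl.
elim: m n A => [|m IHm] n A satA.
  by exists 0%N; rewrite [A]flatmx0.
case: n A satA => [|n] A satA; first by exists 0%N; rewrite [A]thinmx0.
have [->|A0] := eqVneq A 0; first by exists 0%N.
have [a [B [a0 redA]]] := @int_reduces_pivot m n A A0.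
have [ua satB] := saturated_block a0 (int_reduces_saturated redA satA).
have [r [rm rn redB]] := IHm _ _ satB.
exists r.+1; split=> //; apply: int_reduces_trans redA _.
rewrite -block_pid_mx.
apply: int_reduces_trans (int_reduces_block _ redB) _.
(* The integer units are [1] and [-1]; the latter costs one sign change. *)
move: ua; rewrite qualifE /= => /orP[] /eqP->; first exact: ReducesRefl.
exact: int_reduces_opp_pivot.
Qed.

Lemma saturated_diagonalizes m n (A : 'M[int]_(m, n)) :
  saturated A -> diagonalizes_to_identity A.
Proof.
move=> /saturated_reduces_pid[r [rm rn redA]]; rewrite /diagonalizes_to_identity.
by rewrite -(int_reduces_rank redA) map_pid_mx rank_pid_mx.
Qed.

(** * Saturation from uniformity and max-flow min-cut *)

Lemma uniform_sum_incidence (R : realFieldType) n (C : {set {set 'I_n}}) :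
  uniform C -> exists2 d : R, 0 <= d & forall y : 'cV[R]_#|C|,
    \sum_i (incidence_mx R C *m y) i 0 = d * max_objective y.
Proof.
move=> unifC; have [C0|[e eC]] := set_0Vmem C.
  exists 0 => // y; rewrite mul0r big1 // => i _; rewrite mxE big1 // => k _.
  by have := enum_valP k; rewrite {2}C0 inE.
(* The factor [d] is the common edge size: after exchanging the sums, each [y k 0] is weighted by
   the sum of column [k]. *)
exists #|e|%:R; rewrite ?ler0n // => y.
under eq_bigr do rewrite mxE; rewrite exchange_big mulr_sumr /=.
apply: eq_bigr => k _; rewrite -mulr_suml; congr (_ * _).
rewrite (unifC _ _ eC (enum_valP k)) -sum1_card natr_sum [RHS]big_mkcond /=.
by apply: eq_bigr => i _; rewrite mxE; case: ifP.
Qed.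

Lemma uniform_mfmc_saturated (R : realFieldType) n (C : {set {set 'I_n}}) :
  uniform C -> max_flow_min_cut R C -> saturated (incidence_mx int C).
Proof.
move=> unifC mfmc c w z c0 cw; set A := incidence_mx int C.
pose toR p (v : 'cV[int]_p) : 'cV[R]_p := map_mx intr v.
have mapA : map_mx intr A = incidence_mx R C :> 'M[R]_(_, _).
  by apply/matrixP=> i k; rewrite !mxE; case: (_ \in _).
(* [N] bounds every [|z k 0|], hence every [|z k 0 / c|], because a nonzero integer [c] has absolute
   value at least 1. This makes [y0] below nonnegative. *)
pose N : int := \sum_k `|z k 0|.
have [v vdef] : exists v : 'cV[int]_n, v = w + A *m const_mx N by eexists.
pose y0 : 'cV[R]_#|C| := c%:~R^-1 *: toR _ z + const_mx N%:~R.
have cR0 : c%:~R != 0 :> R by rewrite intr_eq0.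
have vE : toR _ v = incidence_mx R C *m y0.
  rewrite vdef /toR map_mxD map_mxM mapA map_const_mx mulmxDr; congr (_ + _).
  apply: (scalerI cR0); rewrite -scalemxAr scalerA divff // scale1r.
  by rewrite -mapA -map_mxM -cw map_mxZ.
have y0_ge0 k : 0 <= y0 k 0.
  have c1 : 1 <= `|c%:~R| :> R by rewrite -intr_norm ler1z -gtz0_ge1 normr_gt0.
  rewrite !mxE -[X in _ <= X]opprK oppr_ge0 opprD subr_le0.
  rewrite (le_trans (ler_norm _)) // normrN normrM normfV.
  rewrite ler_pdivrMl ?normr_gt0 // -intr_norm (@le_trans _ _ N%:~R) //.
    by rewrite ler_int /N (bigD1 k) //= lerDl sumr_ge0.
  by rewrite ler_peMl // ler0z sumr_ge0.
have v_ge0 i : 0 <= v i 0.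
  rewrite -(ler0z R); have -> : (v i 0)%:~R = toR _ v i 0 by rewrite mxE.
  rewrite vE mxE sumr_ge0 // => k _; rewrite mulr_ge0 // mxE.
  by case: (_ \in _).
(* As [v] is nonnegative, the absolute value only recasts it as a vector of naturals. *)
pose a : 'cV[nat]_n := \col_i `|v i 0%R|%N.
have aE i : (a i 0)%:R = toR _ v i 0.
  by rewrite !mxE pmulrn gez0_abs.
have [_ [_ [y ->] [[y_ge0 y_le] y_max]]] := mfmc a.
have [d d_ge0 sumA] := uniform_sum_incidence R unifC.
have {}y_max : max_objective y0 <= max_objective (toR _ y).
  by apply: y_max; split=> // i; rewrite aE vE.
have slack_ge0 i : 0 <= (toR _ v - incidence_mx R C *m toR _ y) i 0.
  by rewrite !mxE subr_ge0; have := y_le i; rewrite aE !mxE.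
(* The slacks add up to [d] times the objective of [y0] minus that of [y], which is at most 0 by
   optimality of [y]. Being nonnegative, they all vanish. *)
have slack0 : \sum_i (toR _ v - incidence_mx R C *m toR _ y) i 0 = 0.
  apply/le_anti; rewrite sumr_ge0 ?andbT => [|i _]; last exact: slack_ge0.
  by rewrite vE -mulmxBr sumA mulr_ge0_le0 // /max_objective;
     under eq_bigr do rewrite mxE [X in _ + X]mxE; rewrite sumrB subr_le0.
have vAy : v = A *m y.
  apply/matrixP=> i j; rewrite ord1; apply/eqP; rewrite -subr_eq0 -(intr_eq0 R).
  have /psumr_eq0P := slack0 => /(_ (fun i _ => slack_ge0 i) i isT).
  by rewrite -mapA -map_mxM !mxE rmorphB /= => ->.
(* Subtracting [N] from every coefficient undoes the shift from [w] to [v]. *)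
by exists (y - const_mx N); rewrite mulmxBr -vAy vdef addrK.
Qed.

Unset Implicit Arguments.
Set Strict Implicit.

Theorem corollary3p8 (R : realFieldType) (n : nat) (C : {set {set 'I_n}})
  (hC : is_clutter C) (hiso : no_isolated_vertex C)
  (hunif : uniform C) (hmfmc : max_flow_min_cut R C) :
  diagonalizes_to_identity (incidence_mx int C).
Proof.
exact: saturated_diagonalizes (uniform_mfmc_saturated hunif hmfmc).
Qed.
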